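(* Let $S_k$ denote the $k$-th period-doubling sequence and let $\mathrm{z}_{\mathrm{End}}(S_k)$ denote the number of phrases of the LZ-End factorization of $S_k$. Then $\mathrm{z}_{\mathrm{End}}(S_k) = 2k - f(k)$ for a function $f$ with $f(k) = O(\log^* k)$.
   Context: Strings are over the binary alphabet $\{a,b\}$. For $c\in\{a,b\}$, $\overline{c}$ is the other letter; for a nonempty string $w$, $\widehat{w} = w[1..|w|-1]\cdot\overline{w[|w|]}$. The period-doubling sequences are $S_0=a$ and $S_k = S_{k-1}\widehat{S_{k-1}}$ for $k\ge 1$ (equivalently $S_k=\phi(S_{k-1})$ with the morphism $\phi(a)=ab$, $\phi(b)=aa$); $|S_k|=2^k$. The LZ-End factorization of a string $w$ is the factorization $w=q_1\cdots q_{z'}$ built greedily from left to right such that, for each $i$, $q_i[1..|q_i|-1]$ is the longest prefix of $q_i\cdots q_{z'}$ that occurs as a suffix of $q_1\cdots q_j$ for some $j<i$ (and $q_i$ is that prefix extended by one more character); as an exception, the last phrase $q_{z'}$ may be a suffix of $w$ that itself occurs as a suffix of $q_1\cdots q_j$ for some $j<z'$. Its number of phrases is $z'$. $\log^*$ is the iterated logarithm. *)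

(* Defs.v *)
From HB Require Import structures.
From mathcomp Require Import all_boot all_order all_algebra.
From mathcomp Require Import all_classical all_reals all_analysis.

Set Implicit Arguments.
Unset Strict Implicit.
Unset Printing Implicit Defensive.

Import Order.TTheory GRing.Theory Num.Theory.

(* The binary alphabet is bool, with a := false and b := true, so that the
   complement of a letter is its boolean negation. *)
Definition letter_a : bool := false.

Definition hat (w : seq bool) : seq bool :=
  rcons (take (size w).-1 w) (~~ last letter_a w).

Fixpoint period_doubling (k : nat) : seq bool :=
  if k is k'.+1 then period_doubling k' ++ hat (period_doubling k')
  else [:: letter_a].

Section LZEnd.
Variable T : eqType.
Implicit Types (p w rest : seq T) (qs : seq (seq T)).

(* The case j = 0 contributes only the empty string; it is what makes the first
   phrase a single character. *)
Definition ends_at_phrase qs p : bool :=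
  [exists j : 'I_(size qs).+1, suffix p (flatten (take j qs))].

Definition lzend_len qs rest : nat :=
  \max_(l < (size rest).+1 | ends_at_phrase qs (take l rest)) l.

(* When lzend_len qs rest = size rest, take (lzend_len qs rest).+1 rest is rest
   itself: this is the exception for the last phrase. The first argument is
   fuel; every phrase consumes at least one character, so size w suffices. *)
Fixpoint lzend_rec (n : nat) qs rest : seq (seq T) :=
  match n, rest with
  | n'.+1, _ :: _ =>
      let l := lzend_len qs rest in
      lzend_rec n' (rcons qs (take l.+1 rest)) (drop l.+1 rest)
  | _, _ => qs
  end.

Definition lzend w : seq (seq T) := lzend_rec (size w) [::] w.

Definition z_End w : nat := size (lzend w).

(* q is a correct phrase when preceded by the phrases qs and followed by the
   phrases tl; the second disjunct is the exception for the last phrase. *)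
Definition lzend_phrase qs q (tl : seq (seq T)) : Prop :=
  (exists p c, [/\ q = rcons p c, ends_at_phrase qs p &
     forall p', prefix p' (q ++ flatten tl) -> ends_at_phrase qs p' ->
       size p' <= size p])
  \/ [/\ tl = [::], q <> [::] & ends_at_phrase qs q].

Definition is_lzend w qs : Prop :=
  flatten qs = w /\
  forall i, i < size qs ->
    lzend_phrase (take i qs) (nth [::] qs i) (drop i.+1 qs).

Lemma ends_at_phrase0 qs : ends_at_phrase qs [::].
Proof. by apply/existsP; exists ord0; rewrite suffix0s. Qed.

Lemma lzend_lenP qs rest :
  [/\ lzend_len qs rest <= size rest,
      ends_at_phrase qs (take (lzend_len qs rest) rest) &
      forall p, prefix p rest -> ends_at_phrase qs p ->
        size p <= lzend_len qs rest].
Proof.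
have P0 : ends_at_phrase qs (take (@ord0 (size rest)) rest).
  by rewrite take0 ends_at_phrase0.
rewrite /lzend_len; split.
- by apply/bigmax_leqP => i _; rewrite -ltnS.
- by rewrite (bigop.bigmax_eq_arg ord0 P0); case: arg_maxnP.
- move=> p pp ep.
  have sp : size p < (size rest).+1 by rewrite ltnS size_prefix.
  apply: (leq_bigmax_cond (Ordinal sp)) => /=.
  by move: pp; rewrite prefixE => /eqP ->.
Qed.

Lemma lzend_phraseE qs q tl : lzend_phrase qs q tl ->
  q <> [::] /\ q = take (lzend_len qs (q ++ flatten tl)).+1 (q ++ flatten tl).
Proof.
set rest := q ++ _; have [le_l el max_l] := lzend_lenP qs rest.
case=> [[p [c [qE ep maxp]]]|[tl0 q0 eq]].
  split; first by rewrite qE => /(congr1 size); rewrite size_rcons.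
  suff -> : lzend_len qs rest = size p.
    by rewrite /rest qE -(size_rcons p c) take_size_cat.
  apply/eqP; rewrite eqn_leq; apply/andP; split.
    rewrite -{1}(size_takel le_l); apply: maxp => //; exact: prefix_take.
  apply: max_l => //.
  by rewrite /rest qE cat_rcons prefix_prefix.
split=> //; have restE : rest = q by rewrite /rest tl0 cats0.
rewrite take_oversize restE // ltnW // ltnS -{2}restE max_l //.
by rewrite restE prefix_refl.
Qed.

Lemma lzend_rec_sound n qs rest : size rest <= n ->
  exists2 tl, lzend_rec n qs rest = qs ++ tl &
    flatten tl = rest /\
    forall i, i < size tl ->
      lzend_phrase (qs ++ take i tl) (nth [::] tl i) (drop i.+1 tl).
Proof.
elim: n qs rest => [|n IHn] qs [|x s] // Hs; try by exists [::]; rewrite ?cats0.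
set rest := x :: s; set l := lzend_len qs rest.
have [le_l el max_l] := lzend_lenP qs rest; rewrite -/l in le_l el max_l.
have [|tl tlE [ftl Htl]] := IHn (rcons qs (take l.+1 rest)) (drop l.+1 rest).
  by rewrite size_drop subSS (leq_trans (leq_subr _ _)).
exists (take l.+1 rest :: tl); first by rewrite -cat_rcons -tlE.
split; first by rewrite /= -/rest ftl cat_take_drop.
case=> [_ | i /Htl]; last by rewrite /= -cat_rcons.
suff: lzend_phrase qs (take l.+1 rest) tl by rewrite /= cats0 drop0.
move: le_l; rewrite leq_eqVlt => /orP[/eqP lE|lt_l].
  have qE : take l.+1 rest = rest by rewrite take_oversize // lE leqnSn.
  right; rewrite qE; split=> //; last by move: el; rewrite lE take_size.
  have ds : drop l.+1 rest = [::] by rewrite drop_oversize // lE leqnSn.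
  case: tl ftl Htl {tlE} => // q tl; rewrite ds => ftl /(_ 0 isT) /lzend_phraseE[].
  by case: q ftl.
left; exists (take l rest), (nth x rest l); split=> //.
  by rewrite -take_nth.
rewrite ftl cat_take_drop => p' pp' ep'.
by rewrite size_takel ?(ltnW lt_l) // max_l.
Qed.

Lemma lzend_rec_complete n qs tl :
  size (flatten tl) <= n ->
  (forall i, i < size tl ->
    lzend_phrase (qs ++ take i tl) (nth [::] tl i) (drop i.+1 tl)) ->
  lzend_rec n qs (flatten tl) = qs ++ tl.
Proof.
elim: tl n qs => [|q tl IHtl] n qs Hs H.
  by case: n {Hs} => [|n]; rewrite cats0.
have [] := @lzend_phraseE qs q tl.
  by have := H 0 isT; rewrite /= cats0 drop0.
move: Hs; rewrite [flatten _]/= -/(flatten tl); set l := lzend_len _ _ => Hs q0 qE.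
have dE : drop l.+1 (q ++ flatten tl) = flatten tl.
  have := cat_take_drop l.+1 (q ++ flatten tl); rewrite -qE => /eqP.
  by rewrite eqseq_cat // => /andP[_ /eqP].
have -> : lzend_rec n qs (q ++ flatten tl) =
    lzend_rec n.-1 (rcons qs (take l.+1 (q ++ flatten tl)))
      (drop l.+1 (q ++ flatten tl)).
  by rewrite /l; case: (q) n q0 Hs => [//|x s] [].
rewrite dE -qE IHtl ?cat_rcons //.
  by case: (q) n q0 Hs => [//|x s] [|n] // _; rewrite /= size_cat ltnS;
     apply: leq_trans; rewrite leq_addl.
by move=> i /(H i.+1); rewrite /= cat_rcons.
Qed.

Lemma lzendP w qs : is_lzend w qs <-> qs = lzend w.
Proof.
split=> [[<- H]|->]; first by rewrite /lzend lzend_rec_complete.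
by rewrite /lzend; have [tl -> [? ?]] := lzend_rec_sound [::] (leqnn (size w)).
Qed.
End LZEnd.

Section LogStar.
Variable R : realType.
Local Open Scope ring_scope.

Definition log2 (x : R) : R := ln x / ln 2.

Lemma iter_log2_le1 (k : nat) : exists n, iter n log2 k%:R <= 1.
Proof.
suff H m : forall x : R, x <= m.+1%:R -> exists n, iter n log2 x <= 1.
  by apply: (H k); rewrite ler_nat.
elim: m => [|m IHm] x xm; first by exists 0%N.
have [x1|x1] := leP x 1; first by exists 0%N.
have [|n Hn] := IHm (log2 x); last by exists n.+1; rewrite iterSr.
have ln2 : 0 < ln 2 :> R by rewrite ln_gt0 // ltr1n.
rewrite /log2 ler_pdivrMr // -mulr_natl mulr1 mulr_natl -lnXn ?ltr0n //.
rewrite ler_ln ?posrE ?exprn_gt0 ?ltr0n ?(lt_trans ltr01) //.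
by rewrite (le_trans xm) // -natrX ler_nat ltn_expl.
Qed.

(* log* k is the least number of applications of the (real) binary logarithm
   that brings k down to at most 1; in particular log* 0 = log* 1 = 0. *)
Definition log_star (k : nat) : nat := ex_minn (iter_log2_le1 k).

End LogStar.

(* Main.v *)
(** The letter of the period-doubling word at position n >= 1 is the parity of
    the 2-adic valuation of n.  Hence two equal factors of length l at distance
    s satisfy l < 3 * 2 ^ v with v the 2-adic valuation of s, and this
    determines every greedy phrase.

    The phrase ends run through cycles.  A cycle starts with a phrase ending at
    8h, h = 2 ^ n, when the previous phrase ends at 5h.  The next phrase has
    length 5h + 1 and ends at 16h - d with d = 3h - 1.  From then on, from an
    end 8g - d with g a power of two, a square of period 2g gives a phrase of
    length 2g + 1, and the source ending at 8g - d gives a phrase of length 6g,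
    so that two phrases lead to 16g - (d - 1).  When d has dropped to 0 a new
    cycle starts, with n replaced by n + 3 * 2 ^ n.

    Each k thus costs two phrases, except that one phrase is saved per cycle;
    cutting the word at length 2 ^ k leaves at most one further phrase.  The
    starts of the cycles grow like a tower of exponentials, so the number of
    cycles up to k is at most log* k. *)

Require Import Defs.
From mathcomp Require Import all_boot all_order all_algebra.
From mathcomp Require Import all_classical all_reals all_analysis.
From mathcomp Require Import zify.

Set Implicit Arguments.
Unset Strict Implicit.
Unset Printing Implicit Defensive.

Import Order.TTheory GRing.Theory Num.Theory.
Import numFieldNormedType.Exports.

(** * Letters of the period-doubling words and 2-adic valuations *)

(* Positions in words start at 1. *)
Definition pdl (n : nat) : bool := odd (logn 2 n).

Lemma pdl_odd n : odd n -> pdl n = false.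
Proof. by move=> on; rewrite /pdl lognE dvdn2 on !andbF. Qed.

Lemma pdl_pow2M v n : 0 < n -> pdl (2 ^ v * n) = odd v (+) pdl n.
Proof. by move=> n0; rewrite /pdl lognM ?expn_gt0 // pfactorK // oddD. Qed.

Lemma pow2_oddP n : 0 < n -> exists v u, n = 2 ^ v * u.*2.+1.
Proof.
move=> /(pfactor_coprime (isT : prime 2))[u cu nE].
exists (logn 2 n), u./2; rewrite {1}nE mulnC; congr (_ * _).
by move: cu; rewrite coprime2n -{2}(odd_double_half u) => ->.
Qed.

(** The valuation of [r] is below [a], so adding a multiple of 2^a keeps it. *)
Lemma pdl_addMpow2 a q r : 0 < r < 2 ^ a -> pdl (2 ^ a * q + r) = pdl r.
Proof.
move=> /andP[/pow2_oddP[v [u ->]] lt_r].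
have lt_va : v < a.
  rewrite -(ltn_exp2l _ _ (isT : 1 < 2)); apply: leq_ltn_trans lt_r.
  exact: leq_pmulr.
rewrite -(subnKC lt_va) addSnnS expnD -mulnA -mulnDr !pdl_pow2M ?addnS //.
by rewrite !pdl_odd //= ?odd_double // expnS -mulnA oddD oddM odd_double.
Qed.

(** The two valuations are [v + 1] and [v], of opposite parity. *)
Lemma pdl_pow2M_neq v x y : pdl (2 ^ v * (4 * x + 2)) != pdl (2 ^ v * y.*2.+1).
Proof.
have -> : 4 * x + 2 = 2 ^ 1 * x.*2.+1 by lia.
rewrite !pdl_pow2M ?muln_gt0 // !pdl_odd ?oddS ?odd_double //.
by case: (odd v).
Qed.

Lemma size_period_doubling k : size (period_doubling k) = 2 ^ k.
Proof.
elim: k => //= k IHk; rewrite size_cat /hat size_rcons size_take IHk.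
have : 0 < 2 ^ k by rewrite expn_gt0.
rewrite expnS; case: ifP; lia.
Qed.

(** In the second half, 2^k + r with 0 < r < 2^k has the valuation of r, whereas 2^(k+1) has one
    more than 2^k: this is the flipped last letter. *)
Lemma nth_period_doubling k i :
  i < 2 ^ k -> nth false (period_doubling k) i = pdl i.+1.
Proof.
elim: k i => [|k IHk] i; first by case: i.
have k0 : 0 < 2 ^ k by rewrite expn_gt0.
rewrite expnS /= nth_cat size_period_doubling => lt_i.
case: ltnP => [/IHk //|le_i].
rewrite /hat nth_rcons size_takel size_period_doubling ?leq_pred //.
case: ltnP => [lt_i'|ge_i].
  rewrite nth_take // IHk; last by lia.
  rewrite -(pdl_addMpow2 (a := k) 1); last by lia.
  by rewrite muln1; congr pdl; lia.
have -> : i - 2 ^ k == (2 ^ k).-1 by lia.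
rewrite -nth_last size_period_doubling (set_nth_default false); last first.
  by rewrite size_period_doubling; lia.
rewrite IHk; last by lia.
have -> : i.+1 = 2 ^ k.+1 * 1 by rewrite expnS; lia.
by rewrite prednK // -{1}(muln1 (2 ^ k)) !pdl_pow2M //=; case: (odd k).
Qed.

(** * Greedy steps described by the set of phrase ends *)

Section Reach.
Variable T : eqType.
Implicit Types (w x q : seq T) (qs : seq (seq T)) (E : seq nat).

(* After some greedy steps on w, the phrases built so far end exactly at the
   positions listed in E (0 included), the last of them being p. *)
Definition reaches w p E : Prop :=
  exists n qs,
    [/\ lzend w = lzend_rec n qs (drop p w), size w - p <= n,
        size E = (size qs).+1, flatten qs = take p w &
        forall x, ends_at_phrase qs x = has (fun e => suffix x (take e w)) E].

Lemma ends_at_phrase_rcons qs q x :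
  ends_at_phrase (rcons qs q) x =
  suffix x (flatten (rcons qs q)) || ends_at_phrase qs x.
Proof.
apply/existsP/orP => [[[j /= lt_j]]|[sx|/existsP[j]]].
- move: (lt_j); rewrite size_rcons ltnS leq_eqVlt => /orP[/eqP ->|{}lt_j].
    by rewrite -(size_rcons qs q) take_size; left.
  rewrite -cats1 takel_cat => [sx|//]; right.
  by apply/existsP; exists (Ordinal lt_j).
- by exists ord_max; rewrite /= take_size.
- have lt_j : j < (size (rcons qs q)).+1.
    by rewrite size_rcons; apply: ltn_trans (ltn_ord j) _.
  by exists (Ordinal lt_j); rewrite /= -cats1 takel_cat //; have := ltn_ord j.
Qed.

Lemma reaches0 w : reaches w 0 [:: 0].
Proof.
exists (size w), [::]; split; rewrite ?drop0 ?subn0 ?take0 // => x.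
rewrite /= take0 orbF; apply/existsP/idP => [[j]//|sx].
by exists ord0.
Qed.

(** Since [p + l < size w], a letter remains to extend the copy, so the exception for the last
    phrase does not arise. *)
Lemma reaches_step w p E l :
  reaches w p E -> p + l < size w ->
  has (fun e => suffix (take l (drop p w)) (take e w)) E ->
  (forall l', l < l' -> p + l' <= size w ->
     ~~ has (fun e => suffix (take l' (drop p w)) (take e w)) E) ->
  reaches w (p + l).+1 ((p + l).+1 :: E).
Proof.
move=> [n [qs [wE len szE fqs ends]]] lt_pl hl maxl.
have [le_l el max_l] := lzend_lenP qs (drop p w).
have lE : lzend_len qs (drop p w) = l.
  move: le_l el max_l; set l0 := lzend_len _ _; rewrite size_drop => le_l el max_l.
  apply/eqP; rewrite eqn_leq; apply/andP; split.
    rewrite leqNgt; apply/negP => lt_l; have := maxl _ lt_l.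
    by rewrite -ends el => H; have /H : p + l0 <= size w by lia.
  have := max_l (take l (drop p w)); rewrite size_takel ?size_drop; last by lia.
  by apply; rewrite ?prefix_take // ends.
have fE : flatten (rcons qs (take l.+1 (drop p w))) = take (p + l).+1 w.
  by rewrite flatten_rcons fqs -addnS takeD.
exists n.-1, (rcons qs (take l.+1 (drop p w))); split.
- rewrite wE -lE; case: n len {wE} => [|n] len; first by lia.
  rewrite -addnS addnC -drop_drop.
  case dE: (drop p w) => [|x s] //.
  by move/(congr1 size): dE; rewrite size_drop /=; lia.
- by lia.
- by rewrite /= szE size_rcons.
- by [].
- by move=> x; rewrite ends_at_phrase_rcons fE ends.
Qed.

Lemma z_End_reaches w E : reaches w (size w) E -> z_End w = (size E).-1.
Proof.
by move=> [n [qs [wE _ szE _ _]]]; rewrite /z_End wE drop_size szE; case: (n).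
Qed.

(** A copy of length [l] leaves at most one letter, so one more phrase finishes the word; the entry
    0 of [E] makes up for it in the count. *)
Lemma z_End_reaches_last w p E l :
  reaches w p E -> p < size w -> size w <= p + l.+1 -> p + l <= size w ->
  has (fun e => suffix (take l (drop p w)) (take e w)) E ->
  z_End w = size E.
Proof.
move=> [n [qs [wE len szE fqs ends]]] lt_p le_w ge_w hl.
have [le_l el max_l] := lzend_lenP qs (drop p w).
have := max_l (take l (drop p w)); rewrite prefix_take ends hl => /(_ isT isT).
rewrite size_takel ?size_drop; last by lia.
move=> le_ll; rewrite szE /z_End wE.
case: n len {wE} => [|n] len; first by lia.
have szd := size_drop p w.
case dE: (drop p w) szd => [|x s] szd; first by move: szd => /=; lia.
rewrite /= in szd *; rewrite -dE (@drop_oversize _ _ s); last by lia.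
by case: (n) => [|?] /=; rewrite size_rcons.
Qed.

End Reach.

(** * Equal factors and their distances *)

(* The l letters following position p are the l letters ending at position e. *)
Definition occ (p e l : nat) : Prop :=
  l <= e /\ forall i, i < l -> pdl (p + i).+1 = pdl (e - l + i).+1.

Lemma occ_pdl p e l n n' :
  occ p e l -> p < n <= p + l -> n + e = n' + (p + l) -> pdl n = pdl n'.
Proof.
move=> [le_l H] /andP[lt_n le_n] nE.
have /H : n - p.+1 < l by lia.
have -> : (p + (n - p.+1)).+1 = n by lia.
by have -> : (e - l + (n - p.+1)).+1 = n' by lia.
Qed.

Lemma suffix_period_doubling K p e l : e <= 2 ^ K -> p + l <= 2 ^ K ->
  reflect (occ p e l)
    (suffix (take l (drop p (period_doubling K))) (take e (period_doubling K))).
Proof.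
move=> le_e le_pl; set w := period_doubling K.
have szw : size w = 2 ^ K := size_period_doubling K.
have szl : size (take l (drop p w)) = l by rewrite size_takel // size_drop szw; lia.
have sze : size (take e w) = e by rewrite size_takel // szw.
have nl i : i < l -> nth false (take l (drop p w)) i = pdl (p + i).+1.
  by move=> lt_i; rewrite nth_take // nth_drop nth_period_doubling //; lia.
rewrite suffixE szl sze; apply: (iffP eqP) => [dE|[le_l H]].
  have le_l : l <= e by move/(congr1 size): dE; rewrite size_drop szl sze; lia.
  split=> // i lt_i; rewrite -nl // -dE nth_drop nth_take; last by lia.
  by rewrite nth_period_doubling //; lia.
apply: (@eq_from_nth _ false); first by rewrite size_drop szl sze; lia.
move=> i; rewrite size_drop sze => lt_i; have lt_il : i < l by lia.
rewrite nl // nth_drop nth_take; last by lia.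
by rewrite nth_period_doubling ?H //; lia.
Qed.

Lemma pd_reaches_step K p E l e :
  reaches (period_doubling K) p E -> all (fun e => e <= p) E ->
  p + l < 2 ^ K -> e \in E -> occ p e l ->
  (forall e' l', e' \in E -> l < l' -> ~ occ p e' l') ->
  reaches (period_doubling K) (p + l).+1 ((p + l).+1 :: E).
Proof.
move=> rE /allP le_E lt_pl eE oe maxl; apply: (reaches_step rE).
- by rewrite size_period_doubling.
- apply/hasP; exists e => //; apply/suffix_period_doubling => //; last by lia.
  by have := le_E _ eE; lia.
- move=> l' lt_l; rewrite size_period_doubling => le_l'; apply/hasPn => e' e'E.
  apply/suffix_period_doubling => //; last exact: maxl.
  by have := le_E _ e'E; lia.
Qed.

(* Writing s = 2^v * s' with s' odd for the distance of two equal factors, a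
   multiple 2^v * u in the range of the second one needs u <> 2 and
   u - s' <> 2 modulo 4, which excludes three consecutive values of u. *)
Lemma occ_dvdn a p e l s :
  occ p e l -> e <= p -> 0 < l -> e + s = p + l -> 3 * 2 ^ a <= l.*2 -> 2 ^ a %| s.
Proof.
move=> oe le_e l0 sE le_l.
have [v [u sv]] : exists v u, s = 2 ^ v * u.*2.+1 by apply: pow2_oddP; lia.
have [le_av|lt_va] := leqP a v.
  by rewrite sv dvdn_mulr // dvdn_exp2l.
(* Since v < a, the second factor contains three consecutive multiples of 2^v. *)
have le_g : 3 * 2 ^ v <= l.
  suff : 2 * 2 ^ v <= 2 ^ a by lia.
  by rewrite -expnS leq_exp2l.
have le_s : s <= p by case: oe; lia.
set g := 2 ^ v in sv le_g; have g0 : 0 < g by rewrite expn_gt0.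
pose q := p %/ g.
have le_q : u.*2.+1 <= q by rewrite leq_divRL // mulnC -sv.
have qm := divn_eq p g; rewrite -/q in qm.
have := ltn_pmod p g0; set r := p %% g in qm * => lt_r.
have K x y j : (0 < j <= 3) -> x = q + j -> y + u.*2.+1 = x ->
    pdl (g * x) = pdl (g * y).
  move=> j3 xE yE; apply: (occ_pdl oe); first by nia.
  by nia.
have bad1 j x y : 0 < j <= 3 -> q + j = 4 * x + 2 -> y.*2.+1 + u.*2.+1 = q + j -> False.
  move=> j3 xE yE; have := pdl_pow2M_neq v x y.
  by rewrite -/g (K (4 * x + 2) y.*2.+1 j) ?eqxx //; lia.
have bad2 j x y : 0 < j <= 3 -> q + j = y.*2.+1 -> 4 * x + 2 + u.*2.+1 = q + j -> False.
  move=> j3 yE xE; have := pdl_pow2M_neq v x y.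
  by rewrite -/g (K y.*2.+1 (4 * x + 2) j) ?eqxx //; lia.
exfalso.
(* Unless [q] is 2 modulo 4, some [q + j] is; in that case j = 1 and j = 3 cover both odd residues,
   one of which is that of [u.*2.+1 + 2]. *)
have [j [j3 jE]] : exists j, 0 < j <= 3 /\
    ((q + j) %% 4 = 2 \/ (q + j - u.*2.+1) %% 4 = 2 /\ u.*2.+1 <= q + j).
  have : q %% 4 < 4 by rewrite ltn_mod.
  have [] : q %% 4 = 0 \/ q %% 4 = 1 \/ q %% 4 = 2 \/ q %% 4 = 3 by lia.
    by exists 2; lia.
  case; first by exists 1; lia.
  case; last by exists 3; lia.
  have [] : odd u \/ ~~ odd u by case: (odd u); [left|right].
    by exists 3; lia.
  by exists 1; lia.
case: jE => [xE|[xE le_j]].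
  by apply: (bad1 j ((q + j) %/ 4) ((q + j - u.*2.+1)./2)) => //; lia.
by apply: (bad2 j ((q + j - u.*2.+1) %/ 4) ((q + j)./2)) => //; lia.
Qed.

(** Once the distance of the factors is fixed, one pair of positions of this shape refutes it. *)
Lemma occ_clash v h p e l n n' x y :
  h = 2 ^ v -> occ p e l -> p < n <= p + l -> n + e = n' + (p + l) ->
  n = h * (4 * x + 2) /\ n' = h * y.*2.+1 \/
  n' = h * (4 * x + 2) /\ n = h * y.*2.+1 -> False.
Proof.
move=> hE oe In nE; have := occ_pdl oe In nE => nn' xy.
have := pdl_pow2M_neq v x y; rewrite -hE.
by case: xy => -[<- <-]; rewrite nn' eqxx.
Qed.

Lemma pdl_add_pow2 a r : 0 < r < 2 ^ a -> pdl (2 ^ a + r) = pdl r.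
Proof. by move=> /(pdl_addMpow2 1); rewrite muln1. Qed.

(** * Longest copies at the phrase ends of a cycle *)

Lemma occ_pow2_prefix a e : e < 2 ^ a -> occ (2 ^ a) e e.
Proof.
move=> lt_e; split=> // i lt_i; rewrite subnn -addnS pdl_add_pow2 //; lia.
Qed.

(** Only e = 8h is long enough; the distance is then l itself, a multiple of 2h, hence 6h or 8h. *)
Lemma occ_pow2_max n h e l :
  h = 2 ^ n -> e = 8 * h \/ e <= 5 * h -> 5 * h < l -> ~ occ (8 * h) e l.
Proof.
move=> hE eE lt_l oe.
have h0 : 0 < h by rewrite hE expn_gt0.
have h2 : 2 * h = 2 ^ n.+1 by rewrite expnS hE.
have h8 : 8 * h = 2 ^ n.+3 by rewrite !expnS hE; lia.
have le_l : l <= e by case: oe.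
have e8 : e = 8 * h by lia.
have : 2 ^ n.+1 %| l by apply: (occ_dvdn oe); lia.
rewrite -h2 => /dvdnP[u uE].
have u34 : u = 3 \/ u = 4 by nia.
case: u34 uE => -> uE.
- by apply: (@occ_clash _ _ _ _ _ (12 * h) (6 * h) 1 1 h2 oe); lia.
- by apply: (@occ_clash _ _ _ _ _ (16 * h) (8 * h) 0 0 h8 oe); lia.
Qed.

(** The only multiple of 2h copied is 8h, from 6h, and their valuations have equal parity. *)
Lemma occ_square a h p d :
  h = 2 ^ a -> p + d = 8 * h -> 0 < d < 2 * h -> occ p p (2 * h).
Proof.
move=> hE pE d2; have h2 : 2 * h = 2 ^ a.+1 by rewrite expnS hE.
split=> [|i lt_i]; first by lia.
have [lt_n|gt_n|n8] := ltngtP (p + i).+1 (8 * h).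
- have -> : (p + i).+1 = 2 ^ a.+1 * 3 + ((p + i).+1 - 6 * h) by lia.
  have -> : (p - 2 * h + i).+1 = 2 ^ a.+1 * 2 + ((p + i).+1 - 6 * h) by lia.
  by rewrite !pdl_addMpow2 //; lia.
- have -> : (p + i).+1 = 2 ^ a.+1 * 4 + ((p + i).+1 - 8 * h) by lia.
  have -> : (p - 2 * h + i).+1 = 2 ^ a.+1 * 3 + ((p + i).+1 - 8 * h) by lia.
  by rewrite !pdl_addMpow2 //; lia.
- have -> : (p + i).+1 = 2 ^ a.+1 * 4 by lia.
  have -> : (p - 2 * h + i).+1 = 2 ^ a.+1 * 3 by lia.
  by rewrite !pdl_pow2M.
Qed.

(** The distance is a multiple u * h with 3 <= u <= 7, and each u is refuted by a pair of
    positions. *)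
Lemma occ_square_max a h p d e l :
  h = 2 ^ a -> p + d = 8 * h -> 0 < d -> d.*2 + 2 <= 3 * h ->
  [\/ e = p, e + d <= 4 * h, e = 4 * h | e + d = 5 * h /\ d <= h] ->
  2 * h < l -> ~ occ p e l.
Proof.
move=> hE pE d0 dh eE lt_l oe.
have h0 : 0 < h by rewrite hE expn_gt0.
have h2 : 2 * h = 2 ^ a.+1 by rewrite expnS hE.
have h4 : 4 * h = 2 ^ a.+2 by rewrite !expnS hE; lia.
have le_l : l <= e by case: oe.
have : 2 ^ a %| p + l - e by apply: (occ_dvdn oe); case: eE; lia.
rewrite -hE => /dvdnP[u uE].
have lt_u : u < 8 by nia.
have {}uE : p + l = u * h + e by case: eE; lia.
have u3 : 3 <= u by case: eE; nia.
have : [\/ u = 3, u = 4, u = 5 | (u = 6 \/ u = 7)].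
  case: u lt_u u3 {uE} => [|[|[|[|[|[|[|[|]]]]]]]] // _ _.
  - exact: Or41.
  - exact: Or42.
  - exact: Or43.
  - by apply: Or44; left.
  - by apply: Or44; right.
case=> [u_|u_|u_|[u_|u_]]; rewrite {}u_ {lt_u u3} in uE.
- by apply: (@occ_clash _ _ _ _ _ (9 * h) (6 * h) 1 4 hE oe); case: eE; lia.
- by apply: (@occ_clash _ _ _ _ _ (8 * h) (4 * h) 0 0 h4 oe); case: eE; lia.
(* The position 7h lies after [p] exactly when d > h. *)
- have [lt_hd|le_dh] := ltnP h d.
    by apply: (@occ_clash _ _ _ _ _ (7 * h) (2 * h) 0 3 hE oe); case: eE; lia.
  by apply: (@occ_clash _ _ _ _ _ (10 * h) (5 * h) 2 2 hE oe); case: eE; lia.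
- by apply: (@occ_clash _ _ _ _ _ (10 * h) (4 * h) 0 2 h2 oe); case: eE; lia.
- by apply: (@occ_clash _ _ _ _ _ (9 * h) (2 * h) 0 4 hE oe); case: eE; lia.
Qed.

(** The shift is exactly 8h, and the source lies before 8h. *)
Lemma occ_between_pow2 a h d p e l :
  h = 2 ^ a -> 0 < d <= 2 * h -> p + d = (10 * h).+1 -> e + d = 8 * h ->
  l.+1 = 6 * h -> occ p e l.
Proof.
move=> hE d2 pE eE lE; have h8 : 8 * h = 2 ^ a.+3 by rewrite !expnS hE; lia.
split=> [|i lt_i]; first by lia.
have -> : (p + i).+1 = 2 ^ a.+3 + (e - l + i).+1 by lia.
by rewrite pdl_add_pow2 //; lia.
Qed.

(** The distance is a multiple of 4h and at most p <= 10h, hence 4h or 8h. *)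
Lemma occ_between_pow2_max a h d p e l :
  h = 2 ^ a -> 0 < d <= 2 * h -> p + d = (10 * h).+1 ->
  e + d <= 8 * h \/ e = p -> 6 * h <= l -> ~ occ p e l.
Proof.
move=> hE d2 pE eE le_l oe.
have h0 : 0 < h by rewrite hE expn_gt0.
have h4 : 4 * h = 2 ^ a.+2 by rewrite !expnS hE; lia.
have h8 : 8 * h = 2 ^ a.+3 by rewrite !expnS hE; lia.
have le_le : l <= e by case: oe.
have : 2 ^ a.+2 %| p + l - e by apply: (occ_dvdn oe); lia.
rewrite -h4 => /dvdnP[u uE].
have : u = 1 \/ u = 2 by nia.
case=> u_; rewrite {}u_ in uE.
- by apply: (@occ_clash _ _ _ _ _ (12 * h) (8 * h) 0 1 h4 oe); lia.
- by apply: (@occ_clash _ _ _ _ _ (16 * h) (8 * h) 0 0 h8 oe); lia.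
Qed.

(** Both factors end just before a multiple of 2^a and are shorter than 2^a. This gives the last
    phrase of a cut word. *)
Lemma occ_before_pow2 a k d p e :
  a <= k -> 0 < d <= 2 ^ a -> p + d = 2 ^ k -> e.+1 = 2 ^ a -> occ p e d.-1.
Proof.
move=> le_ak d2 pE eE; split=> [|i lt_i]; first by lia.
have kE : 2 ^ k = 2 ^ a * 2 ^ (k - a) by rewrite -expnD subnKC.
have ka : 0 < 2 ^ (k - a) by rewrite expn_gt0.
have -> : (p + i).+1 = 2 ^ a * (2 ^ (k - a)).-1 + (e - d.-1 + i).+1 by nia.
by rewrite pdl_addMpow2 //; lia.
Qed.

(** * The cycles of phrases *)

(** With h = 2^n, the end 5h is the source of the next phrase, and 4h - 1 that of the last phrase
    when the word stops inside the cycle. *)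
Definition cycle_start K n E : Prop :=
  [/\ reaches (period_doubling K) (8 * 2 ^ n) (8 * 2 ^ n :: E),
      {in E, forall e, e <= 5 * 2 ^ n}, 5 * 2 ^ n \in E & (4 * 2 ^ n).-1 \in E].

(* x is the end from which the last phrase is copied when the word stops at
   2 ^ (a + 3). *)
Definition cycle_mid K (x a d : nat) E : Prop :=
  [/\ reaches (period_doubling K) (8 * 2 ^ a - d) ((8 * 2 ^ a - d) :: E),
      {in E, forall e, [\/ e + d <= 4 * 2 ^ a, e = 4 * 2 ^ a |
                           e + d = 5 * 2 ^ a /\ d <= 2 ^ a]}, x \in E &
      d.*2 + 2 <= 3 * 2 ^ a].

Lemma cycle_start_mid K n E :
  n + 3 < K -> cycle_start K n E ->
  cycle_mid K (4 * 2 ^ n).-1 n.+1 (3 * 2 ^ n).-1 (8 * 2 ^ n :: E).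
Proof.
move=> lt_nK [rE le_E e5 e4]; rewrite /cycle_mid expnS.
have le_K : 2 * 2 ^ (n + 3) <= 2 ^ K by rewrite -expnS leq_exp2l.
have h0 : 0 < 2 ^ n by rewrite expn_gt0.
have h8 : 8 * 2 ^ n = 2 ^ n.+3 by rewrite !expnS; lia.
rewrite addn3 -h8 in le_K; split.
- have -> : 8 * (2 * 2 ^ n) - (3 * 2 ^ n).-1 = (8 * 2 ^ n + 5 * 2 ^ n).+1 by lia.
  apply: (pd_reaches_step rE (e := 5 * 2 ^ n)).
  + by apply/allP => e; rewrite inE => /orP[/eqP ->|/le_E]; lia.
  + by lia.
  + by rewrite inE e5 orbT.
  + by rewrite h8; apply: occ_pow2_prefix; lia.
  + move=> e' l'; rewrite inE => eE; apply: (occ_pow2_max (erefl _)).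
    by case/orP: eE => [/eqP ->|/le_E]; [left|right].
- move=> e; rewrite inE => /orP[/eqP ->|/le_E le_e]; first by apply: Or32; lia.
  by apply: Or31; lia.
- by rewrite inE e4 orbT.
- by lia.
Qed.

Lemma cycle_mid_step K x a d E :
  a + 3 < K -> 0 < d -> cycle_mid K x a d E ->
  let h := 2 ^ a in
  reaches (period_doubling K) (16 * h - d.-1)
    [:: 16 * h - d.-1, (10 * h - d).+1, 8 * h - d & E].
Proof.
move=> lt_aK d0 [rE le_E xE dh] h; rewrite -/h in rE le_E dh.
have le_K : 2 * 2 ^ (a + 3) <= 2 ^ K by rewrite -expnS leq_exp2l.
have h0 : 0 < h by rewrite expn_gt0.
have h8 : 8 * h = 2 ^ a.+3 by rewrite !expnS /h; lia.
rewrite addn3 -h8 in le_K.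
have rB : reaches (period_doubling K) (10 * h - d).+1
    [:: (10 * h - d).+1, 8 * h - d & E].
  have -> : 10 * h - d = 8 * h - d + 2 * h by lia.
  apply: (pd_reaches_step rE (e := 8 * h - d)).
  - apply/allP => e; rewrite inE => /orP[/eqP -> //|/le_E []]; lia.
  - by lia.
  - by rewrite mem_head.
  - by apply: (occ_square (d := d) (erefl _)); lia.
  - move=> e' l'; rewrite inE => eE.
    apply: (occ_square_max (d := d) (erefl _)); try lia.
    by case/orP: eE => [/eqP ->|/le_E[]];
      [constructor 1|constructor 2|constructor 3|constructor 4].
have -> : 16 * h - d.-1 = ((10 * h - d).+1 + (6 * h).-1).+1 by lia.
apply: (pd_reaches_step rB (e := 8 * h - d)).
- apply/allP => e; rewrite !inE => /orP[/eqP -> //|/orP[/eqP ->|/le_E []]]; lia.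
- by lia.
- by rewrite !inE eqxx orbT.
- by apply: (occ_between_pow2 (d := d) (erefl (2 ^ a))); rewrite -/h; lia.
- move=> e' l'; rewrite !inE => eE lt_l.
  apply: (occ_between_pow2_max (d := d) (erefl (2 ^ a))); rewrite -/h; try lia.
  by case/orP: eE => [/eqP ->|/orP[/eqP ->|/le_E []]]; lia.
Qed.

(** In the new scale h' = 2h, d' = d - 1, the middle end is 5h' - d', and 8h - d and all older ends
    are at most 4h' - d'. *)
Lemma cycle_midS K x a d E :
  a + 3 < K -> 0 < d -> cycle_mid K x a d E ->
  cycle_mid K x a.+1 d.-1 [:: (10 * 2 ^ a - d).+1, 8 * 2 ^ a - d & E].
Proof.
move=> lt_aK d0 mE; have := cycle_mid_step lt_aK d0 mE.
case: mE => [_ le_E xE dh] /=; rewrite /cycle_mid expnS.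
set h := 2 ^ a in dh le_E * => rE; have h0 : 0 < h by rewrite expn_gt0.
split; last by lia.
- by have -> : 8 * (2 * h) = 16 * h by lia.
- move=> e; rewrite !inE => /orP[/eqP ->|/orP[/eqP ->|/le_E eE]].
  + by constructor 3; lia.
  + by constructor 1; lia.
  + by constructor 1; case: eE; lia.
- by rewrite !inE xE !orbT.
Qed.

(** For d = 1 the two latest ends before 16h are 10h and 8h - 1, as a start at scale 2h demands. *)
Lemma cycle_mid_start K x a E :
  a + 3 < K -> cycle_mid K x a 1 E ->
  cycle_start K a.+1 [:: (10 * 2 ^ a - 1).+1, 8 * 2 ^ a - 1 & E].
Proof.
move=> lt_aK mE; have := cycle_mid_step (d := 1) lt_aK isT mE.
case: mE => [_ le_E xE dh] /=; rewrite /cycle_start expnS subn0.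
set h := 2 ^ a in dh le_E * => rE; have h0 : 0 < h by rewrite expn_gt0.
split.
- by have -> : 8 * (2 * h) = 16 * h by lia.
- by move=> e; rewrite !inE => /orP[/eqP ->|/orP[/eqP ->|/le_E []]]; lia.
- by rewrite !inE; apply/orP; left; lia.
- by rewrite !inE; apply/orP; right; apply/orP; left; lia.
Qed.

Lemma cycle_mid_iter K n E i :
  n + i + 3 < K -> i.+1 < 3 * 2 ^ n -> cycle_start K n E ->
  exists2 E', cycle_mid K (4 * 2 ^ n).-1 (n + i).+1 ((3 * 2 ^ n).-1 - i) E' &
    size E' = (size E).+1 + i.*2.
Proof.
elim: i => [|i IHi] lt_K lt_i sE.
  exists (8 * 2 ^ n :: E); last by rewrite addn0.
  by rewrite addn0 subn0; apply: cycle_start_mid => //; lia.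
have [||E' mE szE] := IHi _ _ sE; try lia.
exists [:: (10 * 2 ^ (n + i).+1 - ((3 * 2 ^ n).-1 - i)).+1,
          8 * 2 ^ (n + i).+1 - ((3 * 2 ^ n).-1 - i) & E'].
  by rewrite addnS subnS; apply: cycle_midS => //; lia.
by rewrite /= szE; lia.
Qed.

(** One opening phrase and 3h - 1 double steps, h = 2^n, make 6h - 1 phrases, one less than twice
    the growth 3h of the exponent. *)
Lemma cycle_startS K n E :
  n + 3 * 2 ^ n + 3 <= K -> cycle_start K n E ->
  exists2 E', cycle_start K (n + 3 * 2 ^ n) E' &
    size E' = (size E) + (3 * 2 ^ n).*2.-1.
Proof.
move=> le_K sE; have h0 : 0 < 2 ^ n by rewrite expn_gt0.
have [||E' mE szE] := @cycle_mid_iter K n E (3 * 2 ^ n).-2 _ _ sE; try lia.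
have d1 : (3 * 2 ^ n).-1 - (3 * 2 ^ n).-2 = 1 by lia.
rewrite d1 in mE; have aE : (n + (3 * 2 ^ n).-2).+2 = n + 3 * 2 ^ n by lia.
rewrite -aE; eexists; first by apply: cycle_mid_start mE; lia.
by rewrite /= szE; lia.
Qed.

Lemma z_End_cycle_start n E :
  cycle_start (n + 3) n E -> z_End (period_doubling (n + 3)) = size E.
Proof.
move=> [rE _ _ _]; have KE : 8 * 2 ^ n = 2 ^ (n + 3) by rewrite expnD; lia.
by rewrite KE -size_period_doubling in rE; rewrite (z_End_reaches rE).
Qed.

(** The word stops [d] letters after the last end; [d.-1] of them are copied from the end 4 * 2^n -
    1, and one letter completes the phrase. *)
Lemma z_End_cycle_mid n E i :
  i.+1 < 3 * 2 ^ n -> cycle_start (n + i + 4) n E ->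
  z_End (period_doubling (n + i + 4)) = size E + i.+1.*2.
Proof.
move=> lt_i sE; have h0 : 0 < 2 ^ n by rewrite expn_gt0.
have [||E' [rE le_E xE dh] szE] := @cycle_mid_iter _ n E i _ _ sE; try lia.
set d := (3 * 2 ^ n).-1 - i in rE le_E dh.
have KE : 2 ^ (n + i + 4) = 8 * 2 ^ (n + i).+1 by rewrite addn4 !expnS; lia.
have hE : 2 ^ (n + i).+1 = 2 * 2 ^ n * 2 ^ i by rewrite expnS expnD; lia.
have i0 : 0 < 2 ^ i by rewrite expn_gt0.
have le_n : 2 * 2 ^ n <= 2 ^ (n + i).+1 by rewrite hE leq_pmulr.
have n4 : 4 * 2 ^ n = 2 ^ n.+2 by rewrite !expnS; lia.
have d0 : 0 < d by rewrite /d; lia.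
rewrite (z_End_reaches_last rE (l := d.-1)) ?size_period_doubling ?KE; try lia.
- by rewrite /= szE; lia.
- apply/hasP; exists (4 * 2 ^ n).-1; first by rewrite inE xE orbT.
  apply/suffix_period_doubling; rewrite ?KE; try lia.
  by apply: (@occ_before_pow2 n.+2 (n + i + 4)); rewrite ?KE -?n4 /d; lia.
Qed.

(** * The first phrases, by computation *)

Definition occb (p e l : nat) : bool :=
  (l <= e) && all (fun i => pdl (p + i).+1 == pdl (e - l + i).+1) (iota 0 l).

Lemma occP p e l : reflect (occ p e l) (occb p e l).
Proof.
apply: (iffP andP) => [[le_l /allP H]|[le_l H]]; split=> //.
  by move=> i lt_i; apply/eqP/H; rewrite mem_iota.
by apply/allP => i; rewrite mem_iota => /H ->.
Qed.

(** A copy ending at e' has length at most e', so maximality is a finite check. *)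
Lemma pd_reaches_stepb K p E l e :
  reaches (period_doubling K) p E -> p + l < 2 ^ K ->
  [&& all (fun e => e <= p) E, e \in E, occb p e l &
      all (fun e' => all (fun l' => ~~ occb p e' l') (iota l.+1 (e' - l))) E] ->
  reaches (period_doubling K) (p + l).+1 ((p + l).+1 :: E).
Proof.
move=> rE lt_pl /and4P[le_E eE /occP oe /allP maxl].
apply: (pd_reaches_step rE le_E lt_pl eE oe) => e' l' e'E lt_l oe'.
have l'E : l' \in iota l.+1 (e' - l).
  by case: oe' => le_l _; rewrite mem_iota; lia.
by have /negP[] := allP (maxl _ e'E) l' l'E; apply/occP.
Qed.

(** The initial phrases end at 1, 2, 4, 7, 10, 16; with h = 2 the last three are 4h - 1, 5h and
    8h. *)
Lemma cycle_start1 K : 4 <= K -> cycle_start K 1 [:: 10; 7; 4; 2; 1; 0].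
Proof.
move=> le_K; have le16 : 16 <= 2 ^ K by rewrite -[16]/(2 ^ 4) leq_exp2l.
split; [|by apply/allP|by []|by []].
pose w := period_doubling K; have r0 : reaches w 0 [:: 0] := reaches0 w.
have r1 : reaches w 1 [:: 1; 0].
  by apply: (pd_reaches_stepb (l := 0) (e := 0) r0); [lia | vm_compute].
have r2 : reaches w 2 [:: 2; 1; 0].
  by apply: (pd_reaches_stepb (l := 0) (e := 0) r1); [lia | vm_compute].
have r3 : reaches w 4 [:: 4; 2; 1; 0].
  by apply: (pd_reaches_stepb (l := 1) (e := 1) r2); [lia | vm_compute].
have r4 : reaches w 7 [:: 7; 4; 2; 1; 0].
  by apply: (pd_reaches_stepb (l := 2) (e := 2) r3); [lia | vm_compute].
have r5 : reaches w 10 [:: 10; 7; 4; 2; 1; 0].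
  by apply: (pd_reaches_stepb (l := 2) (e := 7) r4); [lia | vm_compute].
have r6 : reaches w 16 [:: 16; 10; 7; 4; 2; 1; 0].
  by apply: (pd_reaches_stepb (l := 5) (e := 7) r5); [lia | vm_compute].
exact: r6.
Qed.

(** * Counting the phrases *)

Fixpoint cycle_exp (t : nat) : nat :=
  if t is t'.+1 then cycle_exp t' + 3 * 2 ^ cycle_exp t' else 1.

Lemma cycle_exp_gt t : t < cycle_exp t.
Proof.
elim: t => //= t IHt; have : 0 < 2 ^ cycle_exp t by rewrite expn_gt0.
by lia.
Qed.

(** The deficit against twice the exponent is 2 at the first start (6 phrases for 2^4) and grows by
    one per cycle. *)
Lemma cycle_start_exp K t : cycle_exp t + 3 <= K ->
  exists2 E, cycle_start K (cycle_exp t) E &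
    size E + t + 2 = 2 * (cycle_exp t + 3).
Proof.
elim: t => [|t IHt] /= le_K.
  by exists [:: 10; 7; 4; 2; 1; 0] => //; apply: cycle_start1.
have [|E sE szE] := IHt; first by lia.
have [E' sE' szE'] := cycle_startS le_K sE.
exists E' => //; have : 0 < 2 ^ cycle_exp t by rewrite expn_gt0.
by lia.
Qed.

Lemma z_End_period_doubling k : 4 <= k ->
  exists2 t, cycle_exp t + 3 <= k & z_End (period_doubling k) + t + 2 = 2 * k.
Proof.
move=> le_k; pose P t := cycle_exp t + 3 <= k.
(* The index sought is that of the last cycle begun by 2^k; cycle 0 begins at 2^4. *)
have exP : exists t, P t by exists 0.
have ubP t : P t -> t <= k by rewrite /P; have := cycle_exp_gt t; lia.
case: (ex_maxnP exP ubP) => t Pt maxt; exists t => //.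
have [E sE szE] := cycle_start_exp Pt.
have lt_k : k < cycle_exp t.+1 + 3.
  by rewrite ltnNge; apply/negP => /maxt; rewrite ltnn.
move: Pt; rewrite /P leq_eqVlt => /orP[/eqP kE|lt_tk].
  by rewrite -kE in sE *; rewrite (z_End_cycle_start sE).
have kE : k = cycle_exp t + (k - cycle_exp t - 4) + 4 by lia.
move: lt_k; rewrite /= => lt_k.
rewrite kE in sE; rewrite {1}kE (z_End_cycle_mid _ sE); last by lia.
by lia.
Qed.

(** * Comparison with the iterated logarithm *)

Local Open Scope classical_set_scope.
Local Open Scope ring_scope.

(** As 2 ^ [cycle_exp t] <= [cycle_exp t.+1], one logarithm undoes at most one cycle. *)
Lemma iter_log2_cycle_exp (R : realType) t (x : R) i :
  (cycle_exp t)%:R < x -> (i <= t)%N -> 1 < iter i (@log2 R) x.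
Proof.
elim: t x i => [|t IHt] x i lt_x; first by rewrite leqn0 => /eqP ->.
case: i => [_|i le_it].
  by rewrite (le_lt_trans _ lt_x) // ler1n (leq_trans _ (cycle_exp_gt _)).
rewrite iterSr; apply: IHt => //.
have ln2 : 0 < ln 2 :> R by rewrite ln_gt0 // ltr1n.
rewrite /log2 ltr_pdivlMr // mulr_natl -lnXn ?ltr0n //.
have lt_2x : 2 ^+ cycle_exp t < x.
  apply: le_lt_trans lt_x; rewrite -natrX ler_nat /=; lia.
by rewrite ltr_ln ?posrE ?exprn_gt0 // (lt_trans _ lt_2x) ?exprn_gt0.
Qed.

Lemma log_star_gt (R : realType) t k :
  (cycle_exp t < k)%N -> (t < log_star R k)%N.
Proof.
move=> lt_k; rewrite /log_star; case: ex_minnP => n le1 _.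
rewrite ltnNge; apply/negP => /(iter_log2_cycle_exp (R := R) (x := k%:R)).
by rewrite ltr_nat lt_k => /(_ isT); rewrite ltNge le1.
Qed.

Theorem theorem1 (R : realType) :
  exists f : nat -> int,
    (forall k : nat, (z_End (period_doubling k))%:Z = 2 * k%:Z - f k) /\
    (fun k : nat => (f k)%:~R : R^o) =O_\oo (fun k : nat => (log_star R k)%:R : R^o).
Proof.
exists (fun k => 2 * k%:Z - (z_End (period_doubling k))%:Z); split.
  by move=> k; rewrite subKr.
(* For k >= 4, f(k) = t + 2 with t < log* k, so f(k) <= log* k + 1 <= 2 log* k. *)
apply/eqO_exP; exists 2 => //; exists 4%N => // k /= le_k.
have [t le_tk zE] := z_End_period_doubling le_k.
have lt_t : (t < log_star R k)%N by apply: log_star_gt; lia.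
have -> : 2 * k%:Z - (z_End (period_doubling k))%:Z = (t + 2)%N%:Z by lia.
by rewrite !normr_nat -natrM ler_nat; lia.
Qed.
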